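(* Let $X$ be a locally compact space. Then $$\mu\big(\mathcal T_P(X)\big)=\big\{C\in\mathcal C(X^* ): C\supseteq\beta X\setminus\upsilon X\big\}\setminus\{\emptyset\}.$$
   Context: Locally compact spaces and compact spaces are assumed Hausdorff. For a Tychonoff space $X$, a one-point extension of $X$ is a Tychonoff space $Y$ containing $X$ as a dense subspace such that $Y\setminus X$ is a singleton; we write $Y=X\cup\{p\}$. Two extensions are identified if there is a homeomorphism between them fixing $X$ pointwise. $\mathcal T(X)$ is the set of all (equivalence classes of) one-point extensions of $X$, and $\mathcal T_P(X)=\{Y\in\mathcal T(X): Y\text{ is pseudocompact}\}$. $\beta X$ is the Stone-Čech compactification of $X$, $\upsilon X\subseteq\beta X$ is the Hewitt realcompactification of $X$, and $X^*=\beta X\setminus X$. $\mathcal C(T)$ is the set of all closed subsets of a space $T$. For $Y=X\cup\{p\}\in\mathcal T(X)$, $F_Y:\beta X\to\beta Y$ is the unique continuous function with $F_Y|X=\mathrm{id}_X$, and $\mu(Y)=F_Y^{-1}(p)$, a non-empty closed subset of $X^*$. *)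

(* Defs.v *)
From HB Require Import structures.
From mathcomp Require Import all_boot all_order all_algebra.
From mathcomp Require Import all_classical all_reals all_analysis.

Set Implicit Arguments.
Unset Strict Implicit.
Unset Printing Implicit Defensive.

Import Order.TTheory GRing.Theory Num.Theory.
Import numFieldNormedType.Exports.

Local Open Scope classical_set_scope.
Local Open Scope ring_scope.

Definition tychonoff_space (T : topologicalType) :=
  hausdorff_space T /\ completely_regular_space T.

Definition topological_embedding (S T : topologicalType) (f : S -> T) :=
  injective f /\
  forall U : set S, open U <-> exists2 V : set T, open V & f @^-1` V = U.

Definition homeomorphism (S T : topologicalType) (f : S -> T) :=
  [/\ continuous f, bijective f & forall U, open U -> open (f @` U)].

(* The ordinary definition of pseudocompactness also asks for complete
   regularity, which is already part of [one_point_extension] below. *)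
Definition pseudocompact_space (R : realType) (T : topologicalType) :=
  forall f : T -> R, continuous f -> exists M : R, forall t, `|f t| <= M.

(* Realcompact = homeomorphic to a closed subspace of a power of R. *)
Definition realcompact_space (R : realType) (T : topologicalType) :=
  exists (I : Type) (h : T -> prod_topology (fun _ : I => R)),
    topological_embedding h /\ closed (range h).

(* [subspace S] lives on the whole type and makes the points outside S
   isolated, hence the separate inclusion in S. *)
Definition closed_subsets (T : topologicalType) (S : set T) : set (set T) :=
  [set C | C `<=` S /\ closed (C : set (subspace S))].

Lemma initial_cvgP (S : choiceType) (T : topologicalType) (g : S -> T)
    (F : set_system S) (s : S) : Filter F ->
  F --> (s : initial_topology g) <-> g @ F --> g s.
Proof.
move=> FF; split=> [cF|cF].
  by apply: cvg_comp cF _; exact: initial_continuous.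
move=> A [_ [[B oB <-] Bs sBA]]; apply: filterS sBA _.
by apply: cF; exact: open_nbhs_nbhs.
Qed.

Lemma prod_cvgP (I : Type) (T : I -> topologicalType)
    (F : set_system (prod_topology T)) (t : prod_topology T) : Filter F ->
  F --> t <-> forall i, (fun g : prod_topology T => g i) @ F --> t i.
Proof.
move=> FF; split=> [/cvg_sup cF i|cF].
  by have /initial_cvgP := cF i.
by apply/cvg_sup => i; apply/initial_cvgP; exact: cF.
Qed.

Lemma embedding_cvgP (S T : topologicalType) (f : S -> T) (F : set_system S)
    (s : S) : topological_embedding f -> Filter F ->
  F --> s <-> f @ F --> f s.
Proof.
move=> [_ fo] FF; split=> [cF|/(@initial_cvgP S T f F s FF) cF] A.
  rewrite nbhsE => -[B [oB Bfs] BA].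
  suff : F (f @^-1` B) by apply: filterS => x; exact: BA.
  by apply: cF; apply: open_nbhs_nbhs; split => //; apply/fo; exists B.
rewrite nbhsE => -[B [/fo[V oV <-] Bs] BA]; apply: filterS BA _; apply: cF.
by apply: open_nbhs_nbhs; split => //; exists V.
Qed.

Lemma embedding_continuous (S T : topologicalType) (f : S -> T) :
  topological_embedding f -> continuous f.
Proof. by move=> ef s; have /(embedding_cvgP _ ef) := @cvg_id _ (nbhs s). Qed.

Lemma set_type_cvgP (T : topologicalType) (A : set T) (F : set_system A)
    (a : A) : Filter F -> F --> a <-> set_val @ F --> set_val a.
Proof. by move=> FF; exact: initial_cvgP. Qed.

Lemma set_val_continuous (T : topologicalType) (A : set T) :
  continuous (set_val : A -> T).
Proof. exact: initial_continuous. Qed.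

Lemma compact_set_type (T : topologicalType) (A : set T) :
  compact A -> compact [set: A].
Proof.
move=> cA F PF _.
have GA : (set_val @ F) A.
  by apply: (@filterS _ F _ setT) filterT => x _; exact: (set_valP x).
have [p [Ap clp]] := cA _ (fmap_proper_filter set_val PF) GA.
exists (exist _ p (mem_set Ap)); split=> // U V FU [_ [[W oW <-] Wp WV]].
have GU : (set_val @ F) (set_val @` U).
  by apply: (@filterS _ F _ U) FU => u Uu; exists u.
have pW : nbhs p W by exact: open_nbhs_nbhs.
have [_ [[u Uu <-] Wu]] := clp _ _ GU pW.
by exists u; split => //; exact: WV.
Qed.

Lemma hausdorff_set_type (T : topologicalType) (A : set T) :
  hausdorff_space T -> hausdorff_space A.
Proof.
move=> hT p q clpq; apply: val_inj; apply: hT => U V Up Vq.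
have [r [Ur Vr]] := clpq _ _ (set_val_continuous Up) (set_val_continuous Vq).
by exists (set_val r).
Qed.

Lemma closure_eq_continuous (S T : topologicalType) (f g : S -> T) (D : set S) :
  hausdorff_space T -> continuous f -> continuous g ->
  (forall x, D x -> f x = g x) -> forall x, closure D x -> f x = g x.
Proof.
move=> hT cf cg fg x Dx; apply: hT => A B fxA gxB.
have fA : nbhs x (f @^-1` A) by exact: cf.
have gB : nbhs x (g @^-1` B) by exact: cg.
have [y [Dy [Ay By]]] := Dx _ (filterI fA gB).
by exists (f y); split => //; rewrite fg.
Qed.

Lemma dense_closure (T : topologicalType) (D : set T) :
  dense D -> closure D = setT.
Proof.
move=> dD; rewrite predeqE => x; split => // _ B.
rewrite nbhsE => -[U [oU Ux] UB].
have [|y [Uy Dy]] := dD U _ oU; first by exists x.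
by exists y; split => //; exact: UB.
Qed.

Lemma tychonoff_compact (R : realType) (T : topologicalType) :
  hausdorff_space T -> compact [set: T] -> tychonoff_space T.
Proof.
move=> hT cT; split=> //.
apply: (@normal_completely_regular R).
  exact: compact_normal.
exact: hausdorff_accessible.
Qed.

(* The Stone-Cech compactification of X, as the closure of the image of X under
   evaluation in the cube [0, 1]^C(X, [0, 1]).  Points of [cube] have arbitrary
   real coordinates, but those of [beta] are in [0, 1] ([cube_map_sub]).  The
   universal property is given by [beta_extensionE] and [beta_map_eq]. *)
Section StoneCech.
Variables (R : realType) (X : topologicalType).

Definition unit_map :=
  {f : X -> R | continuous f /\ forall x, 0 <= f x <= 1}.

Definition cube := prod_topology (fun _ : unit_map => R).

Definition cube_map (x : X) : cube := fun f => sval f x.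

Definition beta : topologicalType := set_type (closure (range cube_map)).

Definition beta_incl (x : X) : beta :=
  exist _ (cube_map x) (mem_set (subset_closure (imageT cube_map x))).

Definition beta_remainder : set beta := ~` range beta_incl.

Definition beta_coord (u : unit_map) (p : beta) : R := set_val p u.

Lemma beta_coordE u x : beta_coord u (beta_incl x) = sval u x.
Proof. by []. Qed.

Lemma beta_coord_continuous u : continuous (beta_coord u).
Proof.
move=> p; have /prod_cvgP := (set_type_cvgP p (nbhs_filter p)).1 cvg_id.
exact.
Qed.

Lemma beta_cvgP (F : set_system beta) (p : beta) : Filter F ->
  F --> p <-> forall u, beta_coord u @ F --> beta_coord u p.
Proof.
move=> FF; split=> [cF u|cF]; last by apply/set_type_cvgP/prod_cvgP.
exact: cvg_comp cF (@beta_coord_continuous u p).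
Qed.

Lemma cube_hausdorff : hausdorff_space cube.
Proof.
apply: (@hausdorff_product {classic unit_map} (fun=> R)) => f.
exact: Rhausdorff.
Qed.

Lemma unit_cube_compact :
  compact [set p : cube | forall f, `[0, 1]%classic (p f)].
Proof.
apply: (@tychonoff {classic unit_map} (fun=> R) (fun=> `[0, 1]%classic)) => f.
exact: segment_compact.
Qed.

Lemma cube_map_sub :
  closure (range cube_map) `<=` [set p | forall f, `[0, 1]%classic (p f)].
Proof.
have /closure_id -> := compact_closed cube_hausdorff unit_cube_compact.
apply: closureS => _ [x _ <-] f /=; rewrite in_itv /=.
by case: f => f [cf f01]; exact: f01.
Qed.

Lemma beta_compact : compact [set: beta].
Proof.
apply: compact_set_type; apply: subclosed_compact unit_cube_compact _.
  exact: closed_closure.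
exact: cube_map_sub.
Qed.

Lemma beta_hausdorff : hausdorff_space beta.
Proof. exact: hausdorff_set_type cube_hausdorff. Qed.

Lemma beta_incl_continuous : continuous beta_incl.
Proof. by move=> x; apply/beta_cvgP => -[f [cf f01]]; exact: cf. Qed.

Lemma beta_incl_dense : dense (range beta_incl).
Proof.
move=> U [p Up] oU; move: (oU) => [W oW WU].
have pW : nbhs (set_val p) W.
  by apply: open_nbhs_nbhs; split => //; move: Up; rewrite -WU.
have [_ [[x _ <-] Wx]] := set_valP p _ pW.
by exists (beta_incl x); split; [rewrite -WU|exists x].
Qed.

Lemma tychonoff_unit_map (x : X) (U : set X) : tychonoff_space X ->
  open U -> U x -> exists u : unit_map, sval u x = 0 /\
    forall y, ~ U y -> sval u y = 1.
Proof.
move=> [hX crX] oU Ux.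
have /(uniform_separatorP (R:=R))[f [cf f01 fx fU]] :
    uniform_separator [set x] (~` U).
  by apply: crX; [exact: open_closedC|exact].
have f01' z : 0 <= f z <= 1.
  by have := f01 (f z) (imageT f z); rewrite /= in_itv.
exists (exist _ f (conj cf f01')); split=> [|y Uy] /=.
  by apply: fx; exists x.
by apply: fU; exists y.
Qed.

Lemma beta_incl_embedding :
  tychonoff_space X -> topological_embedding beta_incl.
Proof.
move=> tX; split=> [x y xy|U].
  apply: contrapT => nxy.
  have [||u [ux uy]] := @tychonoff_unit_map x (~` [set y]) tX.
  - apply: closed_openC; apply: accessible_closed_set1.
    by apply: hausdorff_accessible; case: tX.
  - exact: nxy.
  have := congr1 (beta_coord u) xy.
  rewrite !beta_coordE ux uy; last by apply.
  by move/esym/eqP; rewrite oner_eq0.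
split=> [oU|[V oV <-]]; last first.
  by apply: open_comp oV => z _; exact: beta_incl_continuous.
exists (\bigcup_(W in [set W | open W /\ beta_incl @^-1` W `<=` U]) W).
  by apply: bigcup_open => W [].
rewrite predeqE => x; split=> [[W [_ WU] Wx]|Ux]; first exact: WU.
have [u [ux uU]] := tychonoff_unit_map tX oU Ux.
exists (beta_coord u @^-1` [set t | t < 1]).
  split=> [|y].
    by apply: open_comp (@open_lt _ 1) => p _; exact: beta_coord_continuous.
  rewrite /= beta_coordE => uy; apply: contrapT => /uU uy1.
  by rewrite uy1 ltxx in uy.
by rewrite /= beta_coordE ux ltr01.
Qed.

Lemma beta_map_eq (T : topologicalType) (f g : beta -> T) :
  hausdorff_space T -> continuous f -> continuous g ->
  f \o beta_incl =1 g \o beta_incl -> f =1 g.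
Proof.
move=> hT cf cg fg p.
apply: (closure_eq_continuous hT cf cg (D := range beta_incl)).
  by move=> _ [x _ <-]; exact: fg.
by rewrite dense_closure //; exact: beta_incl_dense.
Qed.

End StoneCech.

Section Extension.
Variables (R : realType) (X K : topologicalType).
Hypotheses (cK : compact [set: K]) (hK : hausdorff_space K).
Variables (f : X -> K) (cf : continuous f).

Let pull (u : unit_map R K) : unit_map R X.
Proof.
exists (sval u \o f); case: u => u [cu u01] /=; split=> x; last exact: u01.
by apply: continuous_comp; [exact: cf|exact: cu].
Defined.

Let beta_point (p : beta R X) :
  exists k, forall u, beta_coord u (beta_incl R k) = beta_coord (pull u) p.
Proof.
pose Psi (q : beta R X) : cube R K := fun u => beta_coord (pull u) q.
have cPsi : continuous Psi.
  move=> q; apply/(prod_cvgP _ (fmap_filter Psi (nbhs_filter q))) => u.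
  exact: beta_coord_continuous.
have ccm : continuous (@cube_map R K).
  move=> k; apply/(prod_cvgP _ (fmap_filter (@cube_map R K) (nbhs_filter k))).
  by move=> -[u [cu u01]]; exact: cu.
have clK : closed (range (@cube_map R K)).
  apply: compact_closed; first exact: cube_hausdorff.
  by apply: continuous_compact => //; exact: continuous_subspaceT.
have clP : closed (Psi @^-1` range (@cube_map R K)).
  by apply: preimage_closed => // q _; exact: cPsi.
have : closure (range (@beta_incl R X)) `<=` Psi @^-1` range (@cube_map R K).
  rewrite [X in _ `<=` X](closure_id _).1 //; apply: closureS => _ [x _ <-].
  by exists (f x).
rewrite dense_closure; last exact: beta_incl_dense.
move=> /(_ p I)[k _ kp]; exists k => u.
by rewrite beta_coordE -[RHS]/(Psi p u) -kp.
Qed.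

Lemma beta_extension_exists :
  exists F : beta R X -> K, continuous F /\ F \o @beta_incl R X =1 f.
Proof.
have eK := beta_incl_embedding R (tychonoff_compact R hK cK).
have [F FE] := choice beta_point.
exists F; split=> [p|x] /=.
  apply/(embedding_cvgP _ eK (fmap_filter F (nbhs_filter p))).
  apply/(beta_cvgP _ (fmap_filter _ (fmap_filter F (nbhs_filter p)))) => u.
  rewrite FE -fmap_comp -fmap_comp.
  rewrite (_ : _ \o _ = beta_coord (pull u)); last by apply/funext => q /=.
  exact: beta_coord_continuous.
apply: eK.1; apply: val_inj; apply/funext => u.
exact: FE.
Qed.

Definition beta_extension : beta R X -> K := sval (cid beta_extension_exists).

Lemma beta_extension_continuous : continuous beta_extension.
Proof. exact: (svalP (cid beta_extension_exists)).1. Qed.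

Lemma beta_extensionE x : beta_extension (beta_incl R x) = f x.
Proof. exact: (svalP (cid beta_extension_exists)).2 x. Qed.

End Extension.
Section Trace.
Variables (R : realType) (X : topologicalType).
Local Notation e := (@beta_incl R X).

Definition trace_nbhs (p : beta R X) : set_system X :=
  filter_from (nbhs p) (fun U => e @^-1` U).

#[global] Instance trace_nbhs_filter p : ProperFilter (trace_nbhs p).
Proof.
apply: filter_from_proper.
  apply: filter_from_filter; first by exists setT; exact: filterT.
  by move=> U V pU pV; exists (U `&` V) => //; exact: filterI.
move=> U; rewrite nbhsE => -[V [oV Vp] VU].
have [|q [Vq [x _ xq]]] := @beta_incl_dense R X V _ oV; first by exists p.
by exists x; apply: VU; rewrite xq.
Qed.

Lemma trace_nbhs_cvg p : e @ trace_nbhs p --> p.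
Proof. by move=> U pU; exists U. Qed.

Lemma trace_nbhs_incl x : tychonoff_space X -> trace_nbhs (e x) --> x.
Proof.
move=> tX; apply/(embedding_cvgP _ (beta_incl_embedding R tX)).
exact: trace_nbhs_cvg.
Qed.

Definition C_embedded_in (S : set (beta R X)) :=
  forall f : X -> R, continuous f ->
    exists2 g : beta R X -> R, {within S, continuous g} &
      forall x, g (beta_incl R x) = f x.

(* The Hewitt realcompactification, as the largest subspace of beta X in which
   X is C-embedded; [hewittP] shows that it is the only realcompact subspace of
   beta X that contains X as a C-embedded subspace. *)
Definition hewitt : set (beta R X) :=
  \bigcup_(S in [set S | range e `<=` S /\ C_embedded_in S]) S.

Lemma within_trace_cvg (T : topologicalType) (S : set (beta R X))
    (g : beta R X -> T) (p : beta R X) :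
  range e `<=` S -> {within S, continuous g} -> S p ->
  (g \o e) @ trace_nbhs p --> g p.
Proof.
move=> eS /subspace_continuousP/(_ p) cg Sp A gpA.
have := cg Sp A gpA; rewrite /within /= => pA.
exists [set q | S q -> A (g q)]; first exact: pA.
by move=> x /=; apply; apply: eS; exists x.
Qed.

Lemma within_trace_continuous (T : topologicalType) (S : set (beta R X))
    (g : beta R X -> T) : regular_space T ->
  (forall p, S p -> (g \o e) @ trace_nbhs p --> g p) ->
  {within S, continuous g}.
Proof.
move=> rT gS; apply/subspace_continuousP => p Sp A /rT[B gpB BA].
have [U pU UB] := gS p Sp B gpB.
rewrite /within /=.
have [V [oV Vp] VU] : exists2 V, open_nbhs p V & V `<=` U.
  by move: pU; rewrite nbhsE.
have pV : nbhs p V by exact: open_nbhs_nbhs.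
apply: filterS pV => q Vq Sq; apply: BA => C gqC.
have FC : trace_nbhs q ((g \o e) @^-1` C) by exact: gS.
have FV : trace_nbhs q (e @^-1` V) by exists V => //; exact: open_nbhs_nbhs.
have [x [Cx Vx]] := filter_ex (filterI FC FV).
by exists (g (e x)); split => //; apply: UB; exact: VU.
Qed.

Lemma hewitt_limP p : tychonoff_space X ->
  hewitt p <-> forall f : X -> R, continuous f ->
    cvg (f @ trace_nbhs p).
Proof.
move=> tX; split=> [[S [eS CS] Sp] f cf|pL].
  have [g cg gf] := CS f cf; apply: (@cvgP _ _ (g p)).
  rewrite (_ : f = g \o e); first exact: (within_trace_cvg eS cg Sp).
  by apply/funext => x; rewrite /= gf.
exists [set q | forall f : X -> R, continuous f ->
  cvg (f @ trace_nbhs q)] => //; split=> [_ [x _ <-] f cf|f cf].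
  by apply: (@cvgP _ _ (f x)); apply: cvg_comp (trace_nbhs_incl tX) _; exact: cf.
exists (fun q => lim (f @ trace_nbhs q)) => [|x].
  apply: within_trace_continuous => [|q /(_ f cf) fq].
    exact: uniform_regular.
  rewrite (_ : _ \o _ = f); first exact: fq.
  apply/funext => x /=; apply: cvg_lim; first exact: Rhausdorff.
  by apply: cvg_comp (trace_nbhs_incl tX) _; exact: cf.
apply: cvg_lim; first exact: Rhausdorff.
by apply: cvg_comp (trace_nbhs_incl tX) _; exact: cf.
Qed.

Lemma sub_hewitt : tychonoff_space X -> range e `<=` hewitt.
Proof.
move=> tX _ [x _ <-]; apply/(hewitt_limP _ tX) => f cf.
by apply: (@cvgP _ _ (f x)); apply: cvg_comp (trace_nbhs_incl tX) _; exact: cf.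
Qed.

Lemma hewitt_C_embedded : tychonoff_space X -> C_embedded_in hewitt.
Proof.
move=> tX f cf; exists (fun q => lim (f @ trace_nbhs q)) => [|x].
  apply: within_trace_continuous => [|q /(hewitt_limP _ tX)/(_ f cf) fq].
    exact: uniform_regular.
  rewrite (_ : _ \o _ = f); first exact: fq.
  apply/funext => x /=; apply: cvg_lim; first exact: Rhausdorff.
  by apply: cvg_comp (trace_nbhs_incl tX) _; exact: cf.
apply: cvg_lim; first exact: Rhausdorff.
by apply: cvg_comp (trace_nbhs_incl tX) _; exact: cf.
Qed.

Lemma real_cvg_unique (T : Type) (F : set_system T) (f : T -> R) (a b : R) :
  ProperFilter F -> f @ F --> a -> f @ F --> b -> a = b.
Proof.
move=> PF fa fb.
exact: (@cvg_unique R (@Rhausdorff R) _ (fmap_proper_filter f PF) a b fa fb).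
Qed.

Lemma embedding_comp (S T U : topologicalType) (f : S -> T) (g : T -> U) :
  topological_embedding f -> topological_embedding g ->
  topological_embedding (g \o f).
Proof.
move=> [fi fo] [gi go]; split=> [|A]; first exact: inj_comp.
split=> [/fo[B /go[C oC <-] <-]|[C oC <-]]; first by exists C.
by apply/fo; exists (g @^-1` C) => //; apply/go; exists C.
Qed.

Lemma set_val_embedding (T : topologicalType) (A : set T) :
  topological_embedding (set_val : A -> T).
Proof. by split; [exact: val_inj|]. Qed.

Lemma embedding_factor (S T U : topologicalType) (f : S -> T) (g : T -> U) :
  continuous f -> continuous g -> topological_embedding (g \o f) ->
  topological_embedding f.
Proof.
move=> cf cg [gfi gfo]; split=> [x y xy|A].
  by apply: gfi; rewrite /= xy.
split=> [/gfo[C oC <-]|[B oB <-]].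
  by exists (g @^-1` C) => //; apply: open_comp oC => t _; exact: cg.
by apply: open_comp oB => x _; exact: cf.
Qed.

Lemma hewitt_realcompact : tychonoff_space X ->
  realcompact_space R (set_type hewitt).
Proof.
move=> tX.
pose I := {f : X -> R | continuous f}.
have /choice[g gP] : forall f : I, exists g : beta R X -> R,
    {within hewitt, continuous g} /\ forall x, g (e x) = sval f x.
  move=> [f cf]; have [g cg gf] := hewitt_C_embedded tX cf.
  by exists g.
have gcvg (f : I) p : hewitt p -> sval f @ trace_nbhs p --> g f p.
  move=> Hp; have [cg gf] := gP f.
  rewrite (_ : sval f = g f \o e).
    exact: (within_trace_cvg (sub_hewitt tX) cg Hp).
  by apply/funext => x; rewrite /= gf.
pose h (p : hewitt) : prod_topology (fun _ : I => R) := fun f => g f (set_val p).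
have ch : continuous h.
  move=> p; apply/(prod_cvgP _ (fmap_filter h (nbhs_filter p))) => f.
  have /subspace_sigL_continuousP cgf := (gP f).1.
  exact: cgf.
pose inc (u : unit_map R X) : I := exist _ (sval u) (svalP u).1.
pose pi (r : prod_topology (fun _ : I => R)) : cube R X := fun u => r (inc u).
have cproj (f : I) : continuous (fun r : prod_topology (fun _ : I => R) => r f).
  by move=> r; have /prod_cvgP := @cvg_id _ (nbhs r); exact.
have cpi : continuous pi.
  move=> r; apply/(prod_cvgP _ (fmap_filter pi (nbhs_filter r))) => u.
  exact: cproj.
have hE u (p : hewitt) : h p (inc u) = beta_coord u (set_val p).
  apply: (@real_cvg_unique _ (trace_nbhs (set_val p)) (sval u)).
    exact: (gcvg (inc u) _ (set_valP p)).
  exact: (cvg_comp e (beta_coord u) (@trace_nbhs_cvg (set_val p))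
    (@beta_coord_continuous R X u _)).
have pihE : pi \o h = set_val \o set_val.
  by apply/funext => p; apply/funext => u; exact: hE.
exists I, h; split.
  apply: (embedding_factor ch cpi); rewrite pihE.
  by apply: embedding_comp; exact: set_val_embedding.
move=> r clr.
have clq : closure (range (@cube_map R X)) (pi r).
  have : closed (pi @^-1` closure (range (@cube_map R X))).
    by apply: preimage_closed (@closed_closure _ _) => s _; exact: cpi.
  move=> /closure_id E; move: clr; rewrite -[X in X r]/(_ r).
  suff : closure (range h) `<=` pi @^-1` closure (range (@cube_map R X)) by apply.
  rewrite [X in _ `<=` X]E; apply: closureS => _ [p _ <-].
  rewrite /preimage /= -[pi (h p)]/((pi \o h) p) pihE; exact: set_valP.
pose q : beta R X := exist _ (pi r) (mem_set clq).
have qcvg (f : I) : sval f @ trace_nbhs q --> r f.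
  have cf := svalP f.
  pose phi (t : R) : R := Num.min 1 `|t - r f|.
  have cphi : continuous phi.
    move=> t; apply: (@continuous_min R R (cst 1) (fun s => `|s - r f|)).
      exact: cvg_cst.
    by apply: cvg_norm; apply: cvgB; [exact: cvg_id|exact: cvg_cst].
  pose k x := phi (sval f x).
  have ck : continuous k.
    by move=> x; exact: (cvg_comp (sval f) phi (cf x) (cphi _)).
  have k01 x : 0 <= k x <= 1 by rewrite /k /phi le_min ler01 normr_ge0 ge_min lexx.
  pose u : unit_map R X := exist _ k (conj ck k01).
  have rk : r (inc u) = 0.
    have -> : 0 = phi (r f) by rewrite /phi subrr normr0 min_r.
    apply: (closure_eq_continuous (@Rhausdorff R)
      (f := fun s : prod_topology (fun _ : I => R) => s (inc u))
      (g := fun s : prod_topology (fun _ : I => R) => phi (s f))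
      _ _ _ clr).
    - exact: cproj.
    - by move=> s; exact: (cvg_comp _ phi (cproj f s) (cphi _)).
    - move=> _ [p _ <-].
      apply: (@real_cvg_unique _ (trace_nbhs (set_val p)) k).
        exact: (gcvg (inc u) _ (set_valP p)).
      exact: (cvg_comp _ phi (gcvg f _ (set_valP p)) (cphi _)).
  have k0 : k @ trace_nbhs q --> (0 : R).
    rewrite -rk.
    exact: (cvg_comp e (beta_coord u) (@trace_nbhs_cvg q)
      (@beta_coord_continuous R X u q)).
  apply/cvgrPdist_lt => eps eps0.
  have m0 : 0 < Num.min 1 eps by rewrite lt_min ltr01.
  have /cvgrPdist_lt/(_ _ m0) := k0.
  apply: filterS => x; rewrite sub0r normrN ger0_norm; last by have /andP[] := k01 x.
  rewrite /k /phi distrC lt_min !gt_min ltxx /= => /andP[kx /orP[e1|//]].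
  exact: lt_trans kx e1.
have Hq : hewitt q.
  by apply/(hewitt_limP _ tX) => f cf; apply: (@cvgP _ _ (r (exist _ f cf))); exact: qcvg.
exists (exist _ q (mem_set Hq)) => //; apply/funext => f.
exact: real_cvg_unique (gcvg f q Hq) (qcvg f).
Qed.

Lemma hewittP (S : set (beta R X)) : tychonoff_space X ->
  S = hewitt <-> [/\ range e `<=` S, realcompact_space R (set_type S) &
                     C_embedded_in S].
Proof.
move=> tX; split=> [->|[eS [I [h [eh clh]]] CS]].
  by split; [exact: sub_hewitt|exact: hewitt_realcompact
            |exact: hewitt_C_embedded].
rewrite eqEsubset; split=> [p Sp|p Hp]; first by exists S.
have eSx x : S (e x) by apply: eS; exists x.
pose j x : S := exist _ (e x) (mem_set (eSx x)).
have cj : continuous j.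
  move=> x; apply/(set_type_cvgP _ (fmap_filter j (nbhs_filter x))).
  exact: beta_incl_continuous.
have chj i : continuous (fun x => h (j x) i).
  move=> x; have hi := (prod_cvgP _ (fmap_filter h (nbhs_filter (j x)))).1
    (embedding_continuous eh (x := j x)) i.
  exact: (cvg_comp j (fun s => h s i) (cj x) hi).
pose r : prod_topology (fun _ : I => R) :=
  fun i => lim ((fun x => h (j x) i) @ trace_nbhs p).
have hr : (h \o j) @ trace_nbhs p --> r.
  apply/(prod_cvgP _ (fmap_filter (h \o j) _)) => i.
  exact: ((hewitt_limP _ tX).1 Hp _ (chj i)).
have [s _ sr] : range h r.
  apply: clh => A /hr.
  rewrite -[nbhs _ A]/(trace_nbhs p ((h \o j) @^-1` A)) => pA.
  have [x Ax] := filter_ex pA.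
  by exists (h (j x)); split => //; exists (j x).
have js : j @ trace_nbhs p --> s.
  by apply/(embedding_cvgP _ eh (fmap_filter j _)); rewrite sr.
have es : e @ trace_nbhs p --> set_val s.
  exact: (cvg_comp j set_val js (@set_val_continuous _ _ s)).
have -> : p = set_val s.
  apply: (cvg_unique (@beta_hausdorff R X) _ es).
  exact: trace_nbhs_cvg.
exact: set_valP.
Qed.

End Trace.

(* X is a subspace of its extensions through an embedding.  The set T(X) of
   equivalence classes is represented by all extensions: [mu] takes the same
   value on equivalent ones ([mu_equiv]), so its images are the same. *)
Section OnePointExtension.
Variables (R : realType) (X : topologicalType).

Record one_point_extension := OnePointExtension {
  ext_space : topologicalType;
  ext_incl : X -> ext_space;
  ext_pt : ext_space;
  ext_tychonoff : tychonoff_space ext_space;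
  ext_embedding : topological_embedding ext_incl;
  ext_dense : dense (range ext_incl);
  ext_remainder : ~` range ext_incl = [set ext_pt] }.

Definition ext_equiv (Y Z : one_point_extension) :=
  exists2 h : ext_space Y -> ext_space Z, homeomorphism h &
    h \o @ext_incl Y =1 @ext_incl Z.

Lemma beta_ext_incl_continuous (Y : one_point_extension) :
  continuous (@beta_incl R (ext_space Y) \o @ext_incl Y).
Proof.
move=> x; apply: continuous_comp; last exact: beta_incl_continuous.
exact: embedding_continuous (ext_embedding Y) x.
Qed.

(* F_Y : beta X -> beta Y *)
Definition ext_map (Y : one_point_extension) :
    beta R X -> beta R (ext_space Y) :=
  beta_extension (@beta_compact R _) (@beta_hausdorff R _)
    (@beta_ext_incl_continuous Y).

Lemma ext_mapP (Y : one_point_extension) (F : beta R X -> beta R (ext_space Y)) :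
  F = ext_map Y <-> continuous F /\
    forall x, F (beta_incl R x) = beta_incl R (ext_incl Y x).
Proof.
split=> [->|[cF FE]].
  split; first exact: beta_extension_continuous.
  exact: beta_extensionE.
apply/funext; apply: beta_map_eq => //; first exact: beta_hausdorff.
  exact: beta_extension_continuous.
by move=> x /=; rewrite FE [RHS]beta_extensionE.
Qed.

Definition mu (Y : one_point_extension) : set (beta R X) :=
  ext_map Y @^-1` [set beta_incl R (ext_pt Y)].

Lemma ext_mapE (Y : one_point_extension) x :
  ext_map Y (beta_incl R x) = beta_incl R (ext_incl Y x).
Proof. exact: beta_extensionE. Qed.

Definition pseudocompact_extension (Y : one_point_extension) : Prop :=
  pseudocompact_space R (ext_space Y).

(* [one_point_extension] is too large for the universe of [set]; hence the
   predicate and the explicit image. *)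
Definition mu_image (P : one_point_extension -> Prop) : set (set (beta R X)) :=
  [set C | exists2 Y, P Y & mu Y = C].

Lemma homeomorphism_inv (S T : topologicalType) (h : S -> T) :
  homeomorphism h -> exists g, [/\ homeomorphism g, cancel h g & cancel g h].
Proof.
move=> [ch [g hg gh] oh]; exists g; split=> //; split=> [|| U oU].
- apply/continuousP => U oU; rewrite (_ : g @^-1` U = h @` U); first exact: oh.
  rewrite predeqE => t; split=> [gt|[s Us <-]]; last by rewrite /preimage /= hg.
  by exists (g t).
- by exists h.
rewrite (_ : g @` U = h @^-1` U); first by apply: open_comp oU => s _; exact: ch.
rewrite predeqE => s; split=> [[t Ut <-]|hs]; first by rewrite /preimage /= gh.
by exists (h s).
Qed.

Lemma mu_subset_equiv (Y Z : one_point_extension) :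
  ext_equiv Y Z -> mu Y `<=` mu Z.
Proof.
move=> [h [ch [g hg gh] _] hE] p.
have hpt : h (ext_pt Y) = ext_pt Z.
  have : (~` range (ext_incl Z)) (h (ext_pt Y)).
    move=> [x _ xh]; have : (~` range (ext_incl Y)) (ext_pt Y).
      by rewrite ext_remainder.
    by apply; exists x => //; rewrite -(hg (ext_incl Y x)) [h _]hE xh hg.
  by rewrite ext_remainder.
have cH : continuous (@beta_incl R _ \o h).
  by move=> y; apply: continuous_comp; [exact: ch|exact: beta_incl_continuous].
pose H : beta R (ext_space Y) -> _ := beta_extension (@beta_compact R _) (@beta_hausdorff R _) cH.
have HE y : H (beta_incl R y) = beta_incl R (h y) by exact: beta_extensionE.
have EZ : H \o ext_map Y = ext_map Z.
  apply/ext_mapP; split=> [q|x].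
    apply: continuous_comp; first exact: beta_extension_continuous.
    exact: beta_extension_continuous.
  by rewrite /= ext_mapE HE [h _]hE.
rewrite /mu /preimage /= -EZ /= => ->.
by rewrite HE hpt.
Qed.

Lemma mu_equiv (Y Z : one_point_extension) : ext_equiv Y Z -> mu Y = mu Z.
Proof.
move=> YZ; rewrite eqEsubset; split; first exact: mu_subset_equiv.
apply: mu_subset_equiv; have [h hh hE] := YZ.
have [g [gg hg gh]] := homeomorphism_inv hh.
by exists g => // x; rewrite /= -hE /= hg.
Qed.

End OnePointExtension.

(* Main.v *)
Require Import Defs.
From HB Require Import structures.
From mathcomp Require Import all_boot all_order all_algebra.
From mathcomp Require Import all_classical all_reals all_analysis.
From mathcomp Require Import lra.

(** Write beta X for the Stone-Cech compactification and upsilon X for the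
   Hewitt realcompactification of X.  Both inclusions rest on one remark: a
   continuous f : X -> R has a limit at a point p of beta X as soon as it is
   bounded on the trace of some neighbourhood of p ([bounded_trace_cvg]), since
   a truncation of f then extends to beta X.  So p lies in upsilon X exactly
   when every continuous f is bounded near p.

   Let Y be a pseudocompact extension of X by a point pt and let p lie outside
   [mu Y].  Then p and pt are sent to different points of beta Y, which a unit
   map separates; it yields a continuous w on Y that vanishes near pt and is
   bounded below by 1/4 near the image of p.  For f continuous on X, the
   product w f extends by 0 to a continuous function on Y; it is bounded, hence
   f is bounded near p ([pseudocompact_ext_bounded]).  Therefore p lies in
   upsilon X, which is [hewitt_sub_mu].

   Conversely, let C be a nonempty closed subset of the remainder.  As X is
   locally compact it is open in beta X, so that C is closed in beta X, and
   collapsing C to a point inside the union of X and C gives the required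
   extension.  It is built on [option X] with the topology induced by the
   functions of C(X, [0, 1]) whose extension to beta X vanishes on C, all set to
   0 at the new point; there are enough of them because beta X is completely
   regular ([beta_separate]).
   Its image under [mu] is C ([mu_collapsed]).  If C contains the complement of
   upsilon X, every continuous f on the extension is bounded near each point of
   beta X: near the points of C because f is continuous at the new point, near
   the others because they are in upsilon X.  By compactness of beta X, f is
   bounded ([trace_cvg_bounded]). *)

Set Implicit Arguments.
Unset Strict Implicit.
Unset Printing Implicit Defensive.

Import Order.TTheory GRing.Theory Num.Theory.
Import numFieldNormedType.Exports.

Local Open Scope classical_set_scope.
Local Open Scope ring_scope.

(** * Neighbourhood traces and separation in the Stone-Cech compactification *)

Section BetaTopology.
Variables (R : realType) (X : topologicalType).
Local Notation e := (@beta_incl R X).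

Lemma locally_compact_tychonoff : hausdorff_space X ->
  locally_compact [set: X] -> tychonoff_space X.
Proof.
by move=> hX lcX; split=> //; exact: (@locally_compact_completely_regular X R).
Qed.

(** A dense locally compact subspace is open: if K is a compact neighbourhood of
   x in X and V is open in beta X with trace inside K, then V lies in the
   closure of its trace by density, hence in the image of K, which is compact
   and so closed. *)
Lemma beta_incl_open_range : hausdorff_space X ->
  locally_compact [set: X] -> open (range e).
Proof.
move=> hX lcX; have tX := locally_compact_tychonoff hX lcX.
rewrite openE => _ [x _ <-].
have [K Kx [cK _]] := lcX x I.
have {}Kx : nbhs x K.
  by move: Kx; rewrite /within /=; apply: filterS => y; exact.
move: Kx; rewrite nbhsE => -[U [oU Ux] UK].
have [V oV VU] := ((beta_incl_embedding R tX).2 U).1 oU.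
have ceK : closed (e @` K).
  apply: compact_closed; first exact: beta_hausdorff.
  apply: continuous_compact => //; apply: continuous_subspaceT.
  exact: beta_incl_continuous.
have Vx : nbhs (e x) V.
  by apply: open_nbhs_nbhs; split => //; move: Ux; rewrite -VU.
apply: filterS Vx => q Vq.
suff [y _ <-] : (e @` K) q by exists y.
apply: ceK => W qW.
have [_ [[y _ <-] [Vy Wy]]] : range e `&` (V `&` W) !=set0.
  have : closure (range e) q.
    by rewrite dense_closure //; exact: beta_incl_dense.
  by apply; apply: filterI => //; exact: open_nbhs_nbhs.
exists (e y); split => //; exists y => //; apply: UK.
by move: Vy; rewrite -VU.
Qed.

(** Complete regularity of beta X, with the separating function given by its
   restriction to X so that it can serve as a coordinate. *)
Lemma beta_separate (C : set (beta R X)) (p : beta R X) :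
  closed C -> ~ C p -> exists u : unit_map R X,
    beta_coord u p = 1 /\ forall q, C q -> beta_coord u q = 0.
Proof.
move=> clC nCp.
have tB : tychonoff_space (beta R X).
  exact (@tychonoff_compact R (beta R X) (@beta_hausdorff R X)
    (@beta_compact R X)).
have [[v [cv v01]] /= [vp vC]] :=
  @tychonoff_unit_map R (beta R X) p (~` C) tB (closed_openC clC) nCp.
have cw : continuous (fun q => 1 - v q).
  by move=> q; exact: (cvgB (cvg_cst (1 : R)) (cv q)).
have cu : continuous (fun x => 1 - v (e x)).
  by move=> x; exact: (cvg_comp e _ (@beta_incl_continuous R X x) (cw _)).
have u01 x : 0 <= 1 - v (e x) <= 1 by have := v01 (e x); lra.
exists (exist _ (fun x => 1 - v (e x)) (conj cu u01)).
have uE : beta_coord (exist _ (fun x => 1 - v (e x)) (conj cu u01)) =1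
    (fun q => 1 - v q).
  by apply: (beta_map_eq (@Rhausdorff R)) => //; exact: beta_coord_continuous.
split=> [|q Cq]; rewrite uE ?vp ?subr0 // vC ?subrr //.
Qed.

(** Truncating f at height M + 1 and rescaling to [0, 1] gives a unit map, which
   converges at p because it extends to beta X; near p the rescaling can be
   undone, because there the truncation is f itself. *)
Lemma bounded_trace_cvg (f : X -> R) (p : beta R X) (M : R) : continuous f ->
  trace_nbhs p [set x | `|f x| <= M] -> cvg (f @ trace_nbhs p).
Proof.
move=> cf fM.
have M0 : 0 <= M.
  by have [x xM] := filter_ex fM; exact: le_trans xM.
(* M may be 0, whereas N is used as a divisor. *)
pose N := M + 1.
pose k x := (Num.max (- N) (Num.min N (f x)) + N) / (2 * N).
have ck : continuous k.
  move=> x; apply: cvgM; last exact: cvg_cst.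
  apply: cvgD; last exact: cvg_cst.
  apply: (@continuous_max R X (cst (- N)) (fun y => Num.min N (f y))).
    exact: cvg_cst.
  by apply: (@continuous_min R X (cst N) f); [exact: cvg_cst|exact: cf].
have k01 x : 0 <= k x <= 1.
  have N0 : 0 < N by rewrite /N; lra.
  rewrite /k divr_ge0 /=; [|by rewrite -lerBlDr sub0r le_max lexx|lra].
  rewrite ler_pdivrMr; last lra.
  rewrite mul1r -lerBrDr ge_max ge_min; apply/andP; split; first lra.
  by apply/orP; left; lra.
pose u : unit_map R X := exist _ k (conj ck k01).
have kp : k @ trace_nbhs p --> beta_coord u p.
  exact: (cvg_comp e (beta_coord u) (@trace_nbhs_cvg R X p)
    (@beta_coord_continuous R X u p)).
have : (fun x => k x * (2 * N) - N) @ trace_nbhs p -->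
    beta_coord u p * (2 * N) - N.
  by apply: cvgB; [apply: cvgM => //; exact: cvg_cst|exact: cvg_cst].
move=> fp; apply: (@cvgP _ _ (beta_coord u p * (2 * N) - N)).
apply: cvg_trans fp; apply: near_eq_cvg; apply: filterS fM => x /= fxM.
have /andP[f1 f2] : - M <= f x <= M by rewrite -ler_norml.
rewrite /k min_r; last by rewrite /N; lra.
rewrite max_r; last by rewrite /N; lra.
by rewrite divfK ?addrK //; rewrite /N; lra.
Qed.

Lemma hewitt_bounded (p : beta R X) : tychonoff_space X ->
  (forall f : X -> R, continuous f ->
    exists M, trace_nbhs p [set x | `|f x| <= M]) -> hewitt p.
Proof.
move=> tX pb; apply/(hewitt_limP _ tX) => f cf.
by have [M] := pb f cf; exact: bounded_trace_cvg.
Qed.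

(** Each point of beta X has a neighbourhood on whose trace f is bounded, and by
   compactness finitely many of them suffice; near-coverings express this as a
   bound that holds for all large M. *)
Lemma trace_cvg_bounded (f : X -> R) :
  (forall p : beta R X, cvg (f @ trace_nbhs p)) ->
  exists M : R, forall x, `|f x| <= M.
Proof.
move=> fcvg.
have /compact_near_coveringP := @beta_compact R X.
move=> /(_ R (pinfty_nbhs R) (fun M q => forall x, e x = q -> `|f x| <= M)).
case=> [p _|M0 [_ fM]].
  have /cvg_ex[a fa] := fcvg p.
  have [U pU Ub] : trace_nbhs p [set x | `|f x| < `|a| + 1].
    by apply: (cvgr_norm_lt _ fa); rewrite ltrDl.
  exists (U, [set M | `|a| + 1 < M]) => /=.
    by split => //; exists (`|a| + 1).
  move=> [q M] /= [Uq aM] x xq.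
  by apply: le_trans (ltW aM); apply/ltW/Ub; rewrite /= xq.
by exists (M0 + 1) => x; apply: (fM (M0 + 1)) => //; rewrite ltrDl.
Qed.

End BetaTopology.

(** * The fibre over the added point of an extension *)

Section MuOfExtension.
Variables (R : realType) (X : topologicalType).
Variable Y : one_point_extension X.
Local Notation e := (@beta_incl R X).
Local Notation i := (ext_incl Y).
Local Notation pt := (ext_pt Y).

Lemma ext_incl_pt x : i x <> pt.
Proof.
move=> xp; have : [set pt] (i x) by [].
by rewrite -ext_remainder; apply; exists x.
Qed.

Lemma ext_cases y : y = pt \/ exists x, i x = y.
Proof.
have [[x _ xy]|ny] := pselect (range i y); first by right; exists x.
by left; have : (~` range i) y by []; rewrite ext_remainder.
Qed.

Lemma ext_incl_range_open : open (range i).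
Proof.
rewrite -[range i]setCK ext_remainder; apply: closed_openC.
apply: accessible_closed_set1; apply: hausdorff_accessible.
by case: (ext_tychonoff Y).
Qed.

(** X is open in Y, so continuity at the points of X can be tested on X. *)
Lemma ext_continuous (T : topologicalType) (k : ext_space Y -> T) :
  continuous (k \o i) -> k @ pt --> k pt -> continuous k.
Proof.
move=> ck kpt y; case: (ext_cases y) => [-> //|[x <-]].
move=> A kA; have : nbhs x ((k \o i) @^-1` A) by exact: ck.
rewrite nbhsE => -[U [oU Ux] UA].
have [V oV VU] := ((ext_embedding Y).2 U).1 oU.
have : nbhs (i x) (V `&` range i).
  apply: open_nbhs_nbhs; split; first by apply: openI oV ext_incl_range_open.
  by split; [move: Ux; rewrite -VU|exists x].
apply: filterS => t [Vt [z _ zt]]; move: Vt; rewrite -zt => Vz.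
by apply: UA; rewrite -VU.
Qed.

Lemma mu_closed : closed (@mu R X Y).
Proof.
apply: preimage_closed => [p _|]; first exact: beta_extension_continuous.
apply: accessible_closed_set1; apply: hausdorff_accessible.
exact: beta_hausdorff.
Qed.

Lemma mu_remainder : @mu R X Y `<=` @beta_remainder R X.
Proof.
move=> p pY [x _ xp]; move: pY; rewrite -xp /mu /= ext_mapE.
by move/((beta_incl_embedding R (ext_tychonoff Y)).1)/ext_incl_pt.
Qed.

(** The image of beta X in beta Y is compact, hence closed, and it contains X,
   whose closure in Y contains the added point. *)
Lemma mu_nonempty : @mu R X Y !=set0.
Proof.
have clF : closed (range (@ext_map R X Y)).
  apply: compact_closed; first exact: beta_hausdorff.
  apply: continuous_compact; last exact (@beta_compact R X).
  by apply: continuous_subspaceT; exact: beta_extension_continuous.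
have [p _ pE] : range (@ext_map R X Y) (beta_incl R pt); last by exists p.
apply: clF => A /(@beta_incl_continuous R _ pt).
rewrite nbhs_filterE nbhsE => -[B [oB Bpt] BA].
have [y [By [x _ xy]]] := @ext_dense _ Y _ (ex_intro _ pt Bpt) oB.
exists (@ext_map R X Y (e x)); split; first by exists (e x).
by rewrite ext_mapE xy; exact: BA.
Qed.

(** Multiplying f by a cut-off function that vanishes near the added point makes
   it extendable by 0 to all of Y, where pseudocompactness applies; the cut-off
   stays away from 0 near p because p and the added point have different images
   in beta Y. *)
Lemma pseudocompact_ext_bounded (p : beta R X) (f : X -> R) :
  @pseudocompact_extension R X Y -> ~ @mu R X Y p -> continuous f ->
  exists M, trace_nbhs p [set x | `|f x| <= M].
Proof.
move=> pY np cf.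
have cpt : closed [set beta_incl R pt].
  apply: accessible_closed_set1; apply: hausdorff_accessible.
  exact: beta_hausdorff.
have [v [vp vpt]] := beta_separate cpt np.
have {}vpt := vpt _ erefl.
(* v is 0 at the added point and 1 at the image of p, so w vanishes on a whole
   neighbourhood of the former. *)
pose w y := Num.max 0 (sval v y - 2^-1).
have cv : continuous (sval v) := (svalP v).1.
have cw : continuous w.
  move=> y; apply: (@continuous_max R _ (cst 0) (fun z => sval v z - 2^-1)).
    exact: cvg_cst.
  by apply: cvgB; [exact: cv|exact: cvg_cst].
have /choice[k kE] : forall y, exists t : R,
    (y = pt -> t = 0) /\ forall x, i x = y -> t = w y * f x.
  move=> y; have [->|[x <-]] := ext_cases y.
    by exists 0; split=> // x /ext_incl_pt.
  exists (w (i x) * f x).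
  by split=> [/ext_incl_pt //|x' /(ext_embedding Y).1 ->].
have kiE x : k (i x) = w (i x) * f x by exact: (kE _).2.
have kpt : k pt = 0 by exact: (kE _).1.
have ci : continuous i := embedding_continuous (ext_embedding Y).
have ck : continuous k.
  apply: ext_continuous.
    rewrite (_ : k \o i = fun x => w (i x) * f x); last exact/funext.
    move=> x; apply: cvgM; last exact: cf.
    exact: (cvg_comp i w (ci x) (cw _)).
  rewrite kpt; apply: cvg_near_cst.
  have : nbhs pt (sval v @^-1` [set t | t < 2^-1]).
    apply: cv; apply: open_nbhs_nbhs; split; first exact: open_lt.
    by rewrite /= -beta_coordE vpt invr_gt0.
  apply: filterS => y /= vy; have [->//|[x xy]] := ext_cases y.
  by rewrite -xy kiE /w xy max_l ?mul0r // subr_le0 ltW.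
have [M kM] := pY k ck.
(* Near p, v > 3/4 and therefore w > 1/4. *)
exists (4 * M).
have cvF : continuous (beta_coord v \o @ext_map R X Y).
  move=> q; apply: continuous_comp; first exact: beta_extension_continuous.
  exact: beta_coord_continuous.
have pU : nbhs p ((beta_coord v \o @ext_map R X Y) @^-1` [set t | 3 / 4 < t]).
  apply: cvF; apply: open_nbhs_nbhs; split; first exact: open_gt.
  by rewrite /= vp; lra.
apply: filterS (ex_intro2 _ _ _ pU (fun x => id)) => x.
rewrite /= ext_mapE beta_coordE => vx.
have := kM (i x); rewrite kiE normrM.
have w4 : 4^-1 <= `|w (i x)|.
  rewrite ger0_norm; first by rewrite /w le_max; apply/orP; right; lra.
  by rewrite /w le_max lexx.
have := normr_ge0 (f x); nra.
Qed.

Lemma hewitt_sub_mu : tychonoff_space X -> @pseudocompact_extension R X Y ->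
  ~` (@hewitt R X) `<=` @mu R X Y.
Proof.
move=> tX pY p nHp; apply: contrapT => nY; apply: nHp.
apply: hewitt_bounded => // f; exact: pseudocompact_ext_bounded.
Qed.

End MuOfExtension.

(** * Collapsing a closed subset of the remainder to a point *)

Section Collapse.
Variables (R : realType) (X : topologicalType).
Hypotheses (hX : hausdorff_space X) (lcX : locally_compact [set: X]).
Variable C : set (beta R X).
Hypotheses (clC : closed C) (CX : C `<=` @beta_remainder R X).
Hypothesis C0 : C !=set0.
Local Notation e := (@beta_incl R X).

Definition null_map :=
  {u : unit_map R X | forall q, C q -> beta_coord u q = 0}.

Definition null_cube := prod_topology (fun _ : null_map => R).

(** On the union of X and C this is the quotient map that collapses C to the
   origin. *)
Definition collapse (q : beta R X) : null_cube :=
  fun u => beta_coord (sval u) q.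

Definition collapse_point (o : option X) : null_cube :=
  if o is Some x then collapse (e x) else fun=> 0.

(** Being induced from a power of the real line, this topology comes from a
   uniformity, so that complete regularity is immediate. *)
Definition collapsed : uniformType := initial_topology collapse_point.

Definition collapsed_incl (x : X) : collapsed := Some x.

Definition collapsed_pt : collapsed := None.

Let tX := locally_compact_tychonoff R hX lcX.

Lemma collapse_continuous : continuous collapse.
Proof.
move=> q; apply/(prod_cvgP _ (fmap_filter collapse (nbhs_filter q))) => u.
exact: beta_coord_continuous.
Qed.

Lemma collapseC q : C q -> collapse q = collapse_point None.
Proof. by move=> Cq; apply/funext => -[u uC]; exact: uC. Qed.

(** The functions that vanish on C still generate the topology of X, because C
   is closed in beta X and misses X. *)
Lemma null_separate (x : X) (U : set X) : open U -> U x ->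
  exists u : null_map, sval (sval u) x = 1 /\
    forall y, ~ U y -> sval (sval u) y = 0.
Proof.
move=> /((beta_incl_embedding R tX).2 U).1[V oV <-] Vx.
have clD : closed (C `|` ~` V) by apply: closedU => //; exact: open_closedC.
have nD : ~ (C `|` ~` V) (e x) by move=> [/CX|//]; apply; exists x.
have [u [ux uD]] := beta_separate clD nD.
exists (exist _ u (fun q Cq => uD q (or_introl Cq))); split; first exact: ux.
by move=> y Vy; exact: (uD (e y) (or_intror Vy)).
Qed.

Lemma collapse_point_inj : injective collapse_point.
Proof.
have SN x : collapse_point (Some x) <> collapse_point None.
  have [u [ux _]] := null_separate openT (I : [set: X] x).
  move=> /(congr1 (fun c : null_cube => c u)).
  rewrite -[LHS]/(sval (sval u) x) ux; apply/eqP; exact: oner_neq0.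
move=> [x|] [y|] //; [|by move/SN|by move/esym/SN].
move=> xy; congr Some; apply: contrapT => nxy.
have oU : open (~` [set y]).
  by apply: closed_openC; apply: accessible_closed_set1;
    exact: hausdorff_accessible.
have [u [ux uy]] := null_separate oU (nxy : (~` [set y]) x).
have : sval (sval u) x = sval (sval u) y.
  exact (congr1 (fun c : null_cube => c u) xy).
rewrite ux uy; last exact.
by apply/eqP; exact: oner_neq0.
Qed.

Lemma collapse_point_embedding :
  topological_embedding (collapse_point : collapsed -> null_cube).
Proof. by split; [exact: collapse_point_inj|]. Qed.

Lemma collapse_coord_continuous (u : null_map) :
  continuous (fun o : collapsed => collapse_point o u).
Proof.
move=> o; have := embedding_continuous collapse_point_embedding (x := o).
move=> /(prod_cvgP _ (fmap_filter collapse_point (nbhs_filter o))) cu.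
exact: cu.
Qed.

Lemma collapsed_tychonoff : tychonoff_space collapsed.
Proof.
split; last exact: (@uniform_completely_regular R).
move=> o1 o2 clo; apply: collapse_point_inj.
apply: (@hausdorff_product {classic null_map} (fun=> R)) => [u|].
  exact: Rhausdorff.
move=> U V oU oV.
have cpc := embedding_continuous collapse_point_embedding.
have [z [Uz Vz]] := clo _ _ (cpc o1 _ oU) (cpc o2 _ oV).
by exists (collapse_point z).
Qed.

Lemma collapsed_incl_continuous : continuous collapsed_incl.
Proof.
move=> x; apply/(embedding_cvgP _ collapse_point_embedding).
exact: (cvg_comp e collapse (@beta_incl_continuous R X x)
  (@collapse_continuous (e x))).
Qed.

Lemma collapsed_incl_embedding : topological_embedding collapsed_incl.
Proof.
split=> [x y []//|U]; split=> [oU|[V oV <-]]; last first.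
  by apply: open_comp oV => x _; exact: collapsed_incl_continuous.
pose O := \bigcup_(W in [set W : set collapsed |
  open W /\ collapsed_incl @^-1` W `<=` U]) W.
exists O; first by apply: bigcup_open => W [].
rewrite predeqE => x; split=> [[W [_ WU] Wx]|Ux]; first exact: WU.
have [u [ux uU]] := null_separate oU Ux.
exists ((fun o : collapsed => collapse_point o u) @^-1` [set t | 0 < t]).
  split=> [|y].
    apply: open_comp (@open_gt _ 0) => o _.
    exact: collapse_coord_continuous.
  rewrite /preimage /= => uy; apply: contrapT => /uU uy0.
  have : 0 < sval (sval u) y by exact: uy.
  by rewrite uy0 ltxx.
have ux0 : 0 < sval (sval u) x by rewrite ux ltr01.
exact: ux0.
Qed.

(** Approaching a point of C from within X means approaching the new point: the
   collapsing map is continuous on beta X and sends C to the origin.  Density,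
   the value of [mu] and pseudocompactness all follow from this. *)
Lemma collapsed_incl_trace p : C p ->
  collapsed_incl @ trace_nbhs p --> collapsed_pt.
Proof.
move=> Cp.
apply/(embedding_cvgP _ collapse_point_embedding (fmap_filter _ _)).
rewrite -[collapse_point _]/(collapse_point None) -(collapseC Cp).
exact: (cvg_comp e collapse (@trace_nbhs_cvg R X p) (@collapse_continuous p)).
Qed.

Lemma collapsed_incl_dense : dense (range collapsed_incl).
Proof.
move=> U [[x|] Ux] oU.
  by exists (collapsed_incl x); split => //; exists x.
have [p Cp] := C0.
have pU : trace_nbhs p (collapsed_incl @^-1` U).
  by apply: (collapsed_incl_trace Cp); exact: open_nbhs_nbhs.
have [x Ux'] := filter_ex pU.
by exists (collapsed_incl x); split => //; exists x.
Qed.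

Lemma collapsed_remainder : ~` range collapsed_incl = [set collapsed_pt].
Proof.
rewrite predeqE => -[x|]; split => //.
  by move=> nx; exfalso; apply: nx; exists x.
by move=> _ [].
Qed.

Definition collapsed_extension : one_point_extension X :=
  OnePointExtension collapsed_tychonoff collapsed_incl_embedding
    collapsed_incl_dense collapsed_remainder.

(** A point outside C is told apart from the new point by a unit map that
   vanishes on C.  At a point p of C, the trace filter of p on X converges in
   the compactification of the extension both to the image of p and to the new
   point, which are therefore equal. *)
Lemma mu_collapsed : @mu R X collapsed_extension = C.
Proof.
have cF : continuous (@ext_map R X collapsed_extension).
  exact: beta_extension_continuous.
rewrite predeqE => p; split=> [pY|Cp].
  apply: contrapT => nCp; have [u [up uC]] := beta_separate clC nCp.
  pose n : null_map := exist _ u uC.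
  have cn := @collapse_coord_continuous n.
  have n01 o : 0 <= collapse_point o n <= 1.
    case: o => [x|] /=; last by rewrite lexx ler01.
    exact: (svalP u).2.
  pose w : unit_map R collapsed :=
    exist _ (fun o : collapsed => collapse_point o n) (conj cn n01).
  have wE : beta_coord w \o @ext_map R X collapsed_extension =1 beta_coord u.
    apply: (beta_map_eq (@Rhausdorff R)) => [q||x].
    - apply: continuous_comp; first exact: cF.
      exact: beta_coord_continuous.
    - exact: beta_coord_continuous.
    - by rewrite /= ext_mapE.
  have := wE p; rewrite /= pY up.
  rewrite -[LHS]/(0 : R); apply/eqP; rewrite eq_sym; exact: oner_neq0.
have eF : @ext_map R X collapsed_extension \o e =
    @beta_incl R collapsed \o collapsed_incl.
  by apply/funext => x; rewrite /= ext_mapE.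
have Fp : (@ext_map R X collapsed_extension \o e) @ trace_nbhs p -->
    @ext_map R X collapsed_extension p.
  exact: (cvg_comp e _ (@trace_nbhs_cvg R X p) (cF p)).
have Fpt : (@ext_map R X collapsed_extension \o e) @ trace_nbhs p -->
    @beta_incl R collapsed collapsed_pt.
  rewrite eF; exact: (cvg_comp _ _ (collapsed_incl_trace Cp)
    (@beta_incl_continuous R collapsed collapsed_pt)).
exact: (cvg_unique (@beta_hausdorff R collapsed) Fp Fpt).
Qed.

(** The restriction to X of a continuous function converges at the points
   of C to its value at the new point, and at the remaining points of beta X
   because these lie in the Hewitt realcompactification. *)
Lemma collapsed_pseudocompact : ~` (@hewitt R X) `<=` C ->
  @pseudocompact_extension R X collapsed_extension.
Proof.
move=> HC f cf.
have cfi : continuous (f \o collapsed_incl).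
  move=> x; exact: (cvg_comp collapsed_incl f
    (@collapsed_incl_continuous x) (cf _)).
have [p|M fM] := @trace_cvg_bounded R X (f \o collapsed_incl).
  have [Cp|nCp] := pselect (C p).
    apply: (@cvgP _ _ (f collapsed_pt)).
    exact: (cvg_comp collapsed_incl f (collapsed_incl_trace Cp) (cf _)).
  have Hp : hewitt p by apply: contrapT => /HC.
  exact: (hewitt_limP p tX).1 Hp _ cfi.
exists (Num.max M `|f collapsed_pt|) => -[x|].
  by rewrite le_max (fM x).
by rewrite le_max lexx orbT.
Qed.

End Collapse.

Theorem theorem2p11 (R : realType) (X : topologicalType)
    (hX : hausdorff_space X) (lcX : locally_compact [set: X]) :
  mu_image (@pseudocompact_extension R X) =
  [set C | closed_subsets (@beta_remainder R X) C /\ ~` (@hewitt R X) `<=` C]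
    `\` [set set0].
Proof.
have tX := locally_compact_tychonoff R hX lcX.
rewrite predeqE => C; split=> [[Y pY <-]|[[[CX clC] HC] C0]].
  split; last by move=> Y0; have [p] := @mu_nonempty R X Y; rewrite Y0.
  split; last exact: hewitt_sub_mu.
  by split; [exact: mu_remainder|apply: closed_subspaceW; exact: mu_closed].
have clB : closed (@beta_remainder R X).
  by apply: open_closedC; exact: beta_incl_open_range.
have {}clC : closed C.
  by move: clC; rewrite -(closed_setSI _ clB) setIidr.
have {}C0 : C !=set0 by apply/set0P/eqP.
exists (collapsed_extension hX lcX clC CX C0).
  exact: collapsed_pseudocompact.
exact: mu_collapsed.
Qed.
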